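(* For every $n\geq 1$ and every permutation $\pi\in S_n$, $\mathrm{cost}(\pi)=\mathrm{cost}(\pi^{*})$, where $\pi^{*}\in S_n$ is the reverse-complement of $\pi$, given by $\pi^{*}_i = n+1-\pi_{n+1-i}$ for $i\in[n]$.
   Context: Permutations are written in one-line notation; $S_n$ is the set of permutations of $[n]=\{1,\dots,n\}$, $id_n = 12\cdots n$, and $\varepsilon$ is the empty sequence. The device $\mathbb{Q}_{\mathrm{cuts}}^{\prime}$ processes configurations $(s_{inp},s_{dev},s_{out})$ of three sequences (input, content of the device, output), starting from $(\pi,\varepsilon,\varepsilon)$ and ending at $(\varepsilon,\varepsilon,\pi')$, using freely chosen operations: push (move the first element of the input to the end of $s_{dev}$); pop (move the first element of $s_{dev}$ to the end of the output); cut/shuffle (if $s_{dev}=s_1\cdots s_m$ with $m\ge2$, choose $k\in\{2,\dots,m\}$ and replace the content by $s_k s_{k+1}\cdots s_m s_1\cdots s_{k-1}$), where immediately after each cut the entire content of the device must be unloaded, i.e. appended in order to the output, leaving the device empty. Such a run is called an iteration, and $\mathbb{Q}_{\mathrm{cuts}}^{\prime}(\pi)$ denotes the set of all possible outputs $\pi'$ on input $\pi$. $(\mathbb{Q}_{\mathrm{cuts}}^{\prime})^{m}(\pi)$ is the set of permutations obtainable from $\pi$ by $m$ successive iterations (the output of each being the input of the next), with $(\mathbb{Q}_{\mathrm{cuts}}^{\prime})^{0}(\pi)=\{\pi\}$. Finally, $\mathrm{cost}(\pi)=\min\{m\ge 0 : id_n\in(\mathbb{Q}_{\mathrm{cuts}}^{\prime})^{m}(\pi)\}$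 for $\pi\in S_n$; in particular $\mathrm{cost}(id_n)=0$. *)

(* Defs.v *)
From Stdlib Require Import Relation_Operators.
From mathcomp Require Import all_boot all_fingroup.
From mathcomp Require Import boolp classical_sets.

Set Implicit Arguments.
Unset Strict Implicit.
Unset Printing Implicit Defensive.

Local Open Scope nat_scope.
Local Open Scope classical_set_scope.

(* (input, content of the device, output) *)
Definition config (T : Type) : Type := (seq T * seq T * seq T)%type.

(* A cut must be followed at once by unloading the whole device, so the two
   form a single transition. *)
Inductive step (T : Type) : config T -> config T -> Prop :=
| step_push x inp dev out :
    step (x :: inp, dev, out) (inp, rcons dev x, out)
| step_pop x inp dev out :
    step (inp, x :: dev, out) (inp, dev, rcons out x)
| step_cut k inp dev out : 2 <= k <= size dev ->
    step (inp, dev, out) (inp, [::], out ++ (drop k.-1 dev ++ take k.-1 dev)).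

Definition run (T : Type) : config T -> config T -> Prop :=
  clos_refl_trans_1n (config T) (@step T).

Definition Qcuts' (T : Type) (s : seq T) : set (seq T) :=
  [set t | run (s, [::], [::]) ([::], [::], t)].

Fixpoint Qcuts'_iter (T : Type) (m : nat) (s : seq T) : set (seq T) :=
  if m is m'.+1 then \bigcup_(t in Qcuts'_iter m' s) Qcuts' t else [set s].

(* MathComp permutations act on {0, ..., n-1}; positions stay 0-based, values
   are shifted to {1, ..., n}. *)
Definition one_line (n : nat) (pi : 'S_n) : seq nat :=
  [seq (pi i : nat).+1 | i <- enum 'I_n].

Definition idn (n : nat) : seq nat := iota 1 n.

Lemma run_trans (T : Type) (a b c : config T) : run a b -> run b c -> run a c.
Proof.
move=> rab rbc; elim: rab rbc => // x y z xy _ IH zc.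
exact: rt1n_trans xy (IH zc).
Qed.

Lemma run_push (T : Type) (s inp dev out : seq T) :
  run (s ++ inp, dev, out) (inp, dev ++ s, out).
Proof.
elim: s dev => [|x s IHs] dev; first by rewrite cats0; exact: rt1n_refl.
by apply: rt1n_trans (step_push _ _ _ _) _; rewrite -cat_rcons; exact: IHs.
Qed.

Lemma run_through (T : Type) (s out : seq T) :
  run (s, [::], out) ([::], [::], out ++ s).
Proof.
elim: s out => [|x s IHs] out; first by rewrite cats0; exact: rt1n_refl.
apply: rt1n_trans (step_push _ _ _ _) _.
by apply: rt1n_trans (step_pop _ _ _ _) _; rewrite -cat_rcons; exact: IHs.
Qed.

Lemma Qcuts'_block_swap (T : Type) (s1 s2 s3 : seq T) :
  Qcuts' (s1 ++ s2 ++ s3) (s2 ++ s1 ++ s3).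
Proof.
rewrite /Qcuts' /=; case: s1 => [|x s1]; first exact: run_through.
case: s2 => [|y s2]; first exact: run_through.
rewrite catA; apply: run_trans (run_push _ _ _ _) _.
apply: rt1n_trans (@step_cut _ (size (x :: s1)).+1 _ _ _ _) _.
  by rewrite cat0s size_cat /= addnS !ltnS leq_addr.
rewrite /= drop_size_cat // take_size_cat //.
by have := run_through s3 ((y :: s2) ++ (x :: s1)); rewrite -catA.
Qed.

Lemma Qcuts'_iter_perm_eq (T : eqType) (s t : seq T) :
  perm_eq s t -> exists m, Qcuts'_iter m s t.
Proof.
move=> st; apply: (catCA_perm_ind (P := fun u => exists m, Qcuts'_iter m s u) _ st).
  by move=> s1 s2 s3 [m sm]; exists m.+1; exists (s1 ++ s2 ++ s3) => //;
     exact: Qcuts'_block_swap.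
by exists 0.
Qed.

Lemma perm_one_line (n : nat) (pi : 'S_n) : perm_eq (one_line pi) (idn n).
Proof.
rewrite /one_line /idn (map_comp succn (fun i => pi i : nat)).
rewrite -[1]/(1 + 0) iotaDl; apply: perm_map.
rewrite (map_comp val pi) -val_enum_ord; apply: perm_map.
apply: uniq_perm; rewrite ?(map_inj_uniq perm_inj) ?enum_uniq // => i.
by rewrite mem_enum -[i](permKV pi) map_f // mem_enum.
Qed.

Lemma sortable (n : nat) (pi : 'S_n) :
  exists m, `[< Qcuts'_iter m (one_line pi) (idn n) >].
Proof.
by have [m hm] := Qcuts'_iter_perm_eq (perm_one_line pi); exists m; apply/asboolP.
Qed.

Definition cost (n : nat) (pi : 'S_n) : nat := ex_minn (sortable pi).

(* rev_ord i = n - 1 - i is the 0-based form of i |-> n + 1 - i. *)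
Lemma revcomp_inj (n : nat) (pi : 'S_n) :
  injective (fun i : 'I_n => rev_ord (pi (rev_ord i))).
Proof. by move=> i j /rev_ord_inj /perm_inj /rev_ord_inj. Qed.

Definition revcomp (n : nat) (pi : 'S_n) : 'S_n := perm (@revcomp_inj n pi).

(* Main.v *)
Require Import Defs.
From mathcomp Require Import all_boot all_fingroup.
From Stdlib Require Import Relation_Operators.
From mathcomp Require Import boolp.

(** A queue preserves order, so the only rearrangement that one iteration makes
    comes from its cuts, and a cut followed by a full unload exchanges two
    adjacent blocks of the input: the device holds some [a ++ b], a factor of
    the input whose predecessors have all been output, and [b ++ a] is
    appended to the output. One iteration thus cuts the input into consecutive
    factors [a ++ b] and replaces each of them by [b ++ a]; this description is
    the relation [block_swaps], and [Qcuts'P] proves it equivalent to the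
    device.

    The description no longer mentions the direction in which the input is
    read: the mirror image of [a ++ b] becoming [b ++ a] is
    [rev b ++ rev a] becoming [rev a ++ rev b]. Nor does it look at the values.
    So reversing and relabelling both ends of a sorting sequence of iterations
    gives again such a sequence ([Qcuts'_iter_map_rev]). With the relabelling
    [v |-> n + 1 - v] it goes from the reverse-complement of [pi] to that of
    the identity, which is the identity. Hence taking the reverse-complement
    does not increase the cost, and, being an involution, it preserves it. *)

Set Implicit Arguments.
Unset Strict Implicit.
Unset Printing Implicit Defensive.

(** An empty [a] or [b] makes a factor that is left in place, which covers the
    elements that are popped rather than cut. *)
Inductive block_swaps (T : Type) : seq T -> seq T -> Prop :=
| block_swaps_nil : block_swaps [::] [::]
| block_swaps_cons a b s t :
    block_swaps s t -> block_swaps (a ++ b ++ s) (b ++ a ++ t).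

Lemma block_swaps_rcons (T : Type) (a b s t : seq T) :
  block_swaps s t -> block_swaps (s ++ a ++ b) (t ++ b ++ a).
Proof.
elim=> [|c d s' t' _ IHs].
  by have := block_swaps_cons a b (block_swaps_nil T); rewrite !cats0.
by rewrite -!catA; apply: block_swaps_cons.
Qed.

Lemma block_swaps_map_rev (T U : Type) (f : T -> U) (s t : seq T) :
  block_swaps s t -> block_swaps (map f (rev s)) (map f (rev t)).
Proof.
elim=> [|a b s' t' _ IHs]; first exact: block_swaps_nil.
by rewrite !rev_cat !map_cat -!catA; apply: block_swaps_rcons.
Qed.

(** The device is a queue, so [dev ++ inp] is what remains of the input; it is
    the part of the run still to be described by block swaps. *)
Lemma run_block_swaps (T : Type) (c : config T) (t : seq T) :
  run c ([::], [::], t) ->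
  exists2 u, t = c.2 ++ u & block_swaps (c.1.2 ++ c.1.1) u.
Proof.
move e: (_, _, t) => c' r; elim: r e => {c c'} [_ <-|c1 c2 c' st _ IH e] /=.
  by exists [::]; [rewrite cats0 | apply: block_swaps_nil].
case: st (IH e) => [x inp dev out|x inp dev out|k inp dev out _] /= [u -> su].
- by exists u; rewrite // -cat_rcons.
- exists (x :: u); first by rewrite cat_rcons.
  exact: (block_swaps_cons [::] [:: x] su).
- exists ((drop k.-1 dev ++ take k.-1 dev) ++ u); first by rewrite -catA.
  rewrite -{1}(cat_take_drop k.-1 dev) -!catA.
  exact: block_swaps_cons.
Qed.

Lemma block_swaps_run (T : Type) (s t out : seq T) :
  block_swaps s t -> run (s, [::], out) ([::], [::], out ++ t).
Proof.
move=> st; elim: st out => [|a b s' t' _ IHs] out.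
  by rewrite cats0; apply: rt1n_refl.
(* A block alone passes through by pushes and pops. *)
have through c o : run (c ++ s', [::], o) (s', [::], o ++ c).
  elim: c o => [|x c IHc] o; first by rewrite cats0; apply: rt1n_refl.
  apply: rt1n_trans (step_push _ _ _ _) _.
  by apply: rt1n_trans (step_pop _ _ _ _) _; rewrite -cat_rcons; apply: IHc.
rewrite !catA; apply: run_trans (IHs _).
(* The device can only cut a content of two elements or more, at an interior
   position: both blocks must be nonempty. *)
case: a => [|x a]; first by rewrite cats0; apply: through.
case: b => [|y b]; first by rewrite !cats0; apply: through.
apply: run_trans (run_push _ _ _ _) _.
apply: rt1n_trans (@step_cut _ (size (x :: a)).+1 _ _ _ _) _.
  by rewrite cat0s size_cat /= addnS !ltnS leq_addr.
by rewrite cat0s drop_size_cat // take_size_cat // catA; apply: rt1n_refl.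
Qed.

Lemma Qcuts'P (T : Type) (s t : seq T) : Qcuts' s t <-> block_swaps s t.
Proof.
split; last exact: block_swaps_run.
by case/run_block_swaps=> u /= ->.
Qed.

Lemma Qcuts'_iter_map_rev (T U : Type) (f : T -> U) m (s t : seq T) :
  Qcuts'_iter m s t -> Qcuts'_iter m (map f (rev s)) (map f (rev t)).
Proof.
elim: m t => [|m IHm] t /=; first by move=> ->.
case=> u /IHm su /Qcuts'P ut; exists (map f (rev u)) => //.
by apply/Qcuts'P/block_swaps_map_rev.
Qed.

Lemma map_rev_ord_enum n : map (@rev_ord n) (enum 'I_n) = rev (enum 'I_n).
Proof.
case: n => [|n]; first by rewrite (size0nil (size_enum_ord 0)).
apply: (@eq_from_nth _ ord0) => [|i]; first by rewrite size_map size_rev.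
rewrite size_map size_enum_ord => ltin; apply: val_inj.
rewrite (nth_map ord0) ?size_enum_ord // nth_rev ?size_enum_ord //=.
by rewrite !nth_enum_ord // subSS ltnS leq_subr.
Qed.

Lemma one_line_revcomp n (pi : 'S_n) :
  one_line (revcomp pi) = map (subn n.+1) (rev (one_line pi)).
Proof.
rewrite /one_line -map_rev -map_rev_ord_enum -!map_comp.
by apply: eq_map => i /=; rewrite permE /= subSS subnSK.
Qed.

Lemma one_line1 n : one_line (1%g : 'S_n) = idn n.
Proof.
rewrite /one_line /idn -[1]/(1 + 0) iotaDl -val_enum_ord -map_comp.
by apply: eq_map => i /=; rewrite perm1.
Qed.

Lemma revcomp1 n : revcomp (1%g : 'S_n) = 1%g.
Proof. by apply/permP => i; rewrite permE !perm1 rev_ordK. Qed.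

Lemma revcompK n : involutive (@revcomp n).
Proof. by move=> pi; apply/permP => i; rewrite !permE !rev_ordK. Qed.

Lemma cost_revcomp_le n (pi : 'S_n) : cost (revcomp pi) <= cost pi.
Proof.
rewrite {2}/cost; case: ex_minnP => m /asboolP sm _.
rewrite /cost; case: ex_minnP => k _; apply; apply/asboolP.
rewrite -one_line1 -revcomp1 !one_line_revcomp one_line1.
exact: Qcuts'_iter_map_rev.
Qed.

Theorem theorem4p8 (n : nat) (hn : 1 <= n) (pi : 'S_n) :
  cost pi = cost (revcomp pi).
Proof.
apply/eqP; rewrite eqn_leq cost_revcomp_le andbT.
by rewrite -{1}(revcompK pi) cost_revcomp_le.
Qed.
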